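(* Let $K\ge3$, $N\ge2$, $\theta>0$, $p>0$, let $\nu_N$ be the stationary distribution of the $N$-particle process on $\mathcal{E}_{K,N}$ with generator $\mathcal{L}_{K,N}$, and let \[ \beta_N=2\left(1+\frac{p}{(N-1)(1+\theta)}\right). \] - If $K=2K_2$ with $K_2\ge2$, then \[ \operatorname{Var}_{\nu_N}\left[\frac{\eta(0)}{N}\right]=\frac{N-1}{KN}\,\frac{2}{\beta_N+2}\,\frac{T_{K_2}(\beta_N/2)}{U_{K_2-1}(\beta_N/2)}+\frac{1}{KN}-\frac1{K^2}, \] and for all $1\le k\le K_2-1$, \[ \operatorname{Cov}_{\nu_N}\left[\frac{\eta(0)}{N},\frac{\eta(k)}{N}\right]=\frac{N-1}{KN}\,\frac{2}{\beta_N+2}\,\frac{T_{K_2-k}(\beta_N/2)}{U_{K_2-1}(\beta_N/2)}-\frac1{K^2}. \] - If $K=2K_2+1$ with $K_2\ge1$, then \[ \operatorname{Var}_{\nu_N}\left[\frac{\eta(0)}{N}\right]=\frac{N-1}{KN}\,\frac{U_{K_2}(\beta_N/2)-U_{K_2-1}(\beta_N/2)}{U_{K_2}(\beta_N/2)+U_{K_2-1}(\beta_N/2)}+\frac1{KN}-\frac1{K^2}, \] and for all $1\le k\le K_2$, \[ \operatorname{Cov}_{\nu_N}\left[\frac{\eta(0)}{N},\frac{\eta(k)}{N}\right]=\frac{N-1}{KN}\,\frac{U_{K_2-k}(\beta_N/2)-U_{K_2-k-1}(\beta_N/2)}{U_{K_2}(\beta_N/2)+U_{K_2-1}(\beta_N/2)}-\frac1{K^2}.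 \]
   Context: $\mathcal{E}_{K,N}=\{\eta:\mathbb{Z}/K\mathbb{Z}\to\mathbb{N},\ \sum_{k}\eta(k)=N\}$ ($\mathbb{N}$ includes $0$). The generator is \[ (\mathcal{L}_{K,N}f)(\eta)=\sum_{i,j\in\mathbb{Z}/K\mathbb{Z}}\eta(i)\left(\mathbf{1}_{\{j=i+1\}}+\theta\,\mathbf{1}_{\{j=i-1\}}+p\frac{\eta(j)}{N-1}\right)[f(T_{i\to j}\eta)-f(\eta)], \] with $T_{i\to j}\eta=\eta-\mathbf{e}_i+\mathbf{e}_j$ (when $\eta(i)>0$). The process is irreducible and $\nu_N$ is its unique stationary distribution; $\operatorname{Var}_{\nu_N},\operatorname{Cov}_{\nu_N}$ are taken when $\eta$ has law $\nu_N$. $T_n$ and $U_n$ are the Chebyshev polynomials of the first and second kind: both satisfy $p_{n+1}(x)=2x\,p_n(x)-p_{n-1}(x)$ for $n\ge1$, with $T_0=U_0=1$, $T_1(x)=x$, $U_1(x)=2x$; by convention $U_{-1}=0$. *)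

(* Defs.v *)
From HB Require Import structures.
From mathcomp Require Import all_boot all_order all_algebra.
From mathcomp Require Import all_classical all_reals all_analysis.

Set Implicit Arguments.
Unset Strict Implicit.
Unset Printing Implicit Defensive.

Import Order.TTheory GRing.Theory Num.Theory.
Local Open Scope ring_scope.

(* 'Z_K is Z/KZ only for 1 < K (it is Z/2Z for K = 0, 1). *)
Record config (K N : nat) := Config {
  occ :> {ffun 'Z_K -> nat};
  occ_sum : (\sum_(k : 'Z_K) occ k)%N == N
}.

HB.instance Definition _ (K N : nat) := [isSub for @occ K N].
HB.instance Definition _ (K N : nat) := [Countable of config K N by <:].

Lemma config_point_sum (K N : nat) :
  (\sum_(k : 'Z_K) [ffun k : 'Z_K => if k == 0%R then N else 0%N] k)%N == N.
Proof.
rewrite (bigD1 (0 : 'Z_K)) //= ffunE eqxx big1 ?addn0 // => k /negPf k0.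
by rewrite ffunE k0.
Qed.

HB.instance Definition _ (K N : nat) :=
  isPointed.Build (config K N) (Config (config_point_sum K N)).
HB.instance Definition _ (K N : nat) :=
  @isMeasurable.Build default_measure_display (config K N)
    discrete_measurable discrete_measurable0
    discrete_measurableC discrete_measurableU.

(* T_{i->j} eta = eta - e_i + e_j. When eta i = 0 the function below no longer
   has total mass N (the subtraction is truncated), and [insubd] returns eta;
   the generator gives that jump rate 0. *)
Definition jump (K N : nat) (i j : 'Z_K) (eta : config K N) : config K N :=
  insubd eta [ffun k : 'Z_K => (eta k - (k == i) + (k == j))%N].

Lemma jumpE (K N : nat) (i j : 'Z_K) (eta : config K N) : (0 < eta i)%N ->
  occ (jump i j eta) = [ffun k : 'Z_K => (eta k - (k == i) + (k == j))%N].
Proof.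
move=> eta_gt0; rewrite /jump insubdK //.
have sum1 (l : 'Z_K) : (\sum_(k : 'Z_K) (k == l))%N = 1%N.
  by rewrite (bigD1 l) //= eqxx big1 ?addn0 // => k /negPf ->.
rewrite unfold_in; under eq_bigr do rewrite ffunE.
rewrite big_split /= sum1 -(sum1 i) -big_split /=.
rewrite -[X in _ == X](eqP (occ_sum eta)); apply/eqP/eq_bigr => k _.
by rewrite subnK //; case: eqP => [->|].
Qed.

Definition jump_rate (R : realType) (K N : nat) (theta p : R)
    (eta : config K N) (i j : 'Z_K) : R :=
  (eta i)%:R * ((j == i + 1)%:R + theta * (j == i - 1)%:R
                + p * ((eta j)%:R / (N%:R - 1))).

Definition generator (R : realType) (K N : nat) (theta p : R)
    (f : config K N -> R) (eta : config K N) : R :=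
  \sum_(i : 'Z_K) \sum_(j : 'Z_K)
    jump_rate theta p eta i j * (f (jump i j eta) - f eta).

Definition stationary (R : realType) (K N : nat) (theta p : R)
    (nu : probability (config K N) R) : Prop :=
  forall f : config K N -> R, ('E_nu[generator theta p f] = 0)%E.

Definition proportion (R : realType) (K N : nat) (k : 'Z_K) (eta : config K N) : R :=
  (eta k)%:R / N%:R.

Fixpoint chebyshev_rec (R : realType) (p1 : {poly R}) (n : nat) : {poly R} :=
  match n with
  | 0 => 1
  | m.+1 =>
      match m with
      | 0 => p1
      | l.+1 => 2%:P * 'X * chebyshev_rec p1 m - chebyshev_rec p1 l
      end
  end.

Definition chebyshevT (R : realType) (n : nat) : {poly R} :=
  chebyshev_rec 'X n.

(* Indexed by int because of the convention U_{-1} = 0; the value 0 at indices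
   below -1 is arbitrary. *)
Definition chebyshevU (R : realType) (n : int) : {poly R} :=
  match n with
  | Posz m => chebyshev_rec (2%:P * 'X) m
  | Negz _ => 0
  end.

(* Main.v *)
Require Import Defs.
From mathcomp Require Import all_boot all_order all_algebra.
From mathcomp Require Import all_classical all_reals all_analysis.
From mathcomp Require Import zify ring lra.

Set Implicit Arguments.
Unset Strict Implicit.
Unset Printing Implicit Defensive.

Import Order.TTheory GRing.Theory Num.Theory.
Local Open Scope ring_scope.

(** The generator maps polynomials of degree at most two in the occupation
numbers to such polynomials, so the second moments of a stationary law solve a
closed linear system; the theorem is the explicit solution of that system.

Write q = p/(N-1), a = N/K and M(k,l) for the mean of eta(k)eta(l).  In the
drift of eta(k) the mean-field exchange cancels, by the symmetry of
eta(i)eta(j); stationarity says that the means of the eta(k) are balanced around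
the cycle, hence they are all equal (cycle_balance_const), and equal to a because
they sum to N (mean_occ).  The generator of eta(k)eta(l) consists of the two
drifts and a quadratic covariation.  In the covariation the mean-field rates
contribute -2q eta(k)eta(l) off the diagonal and 2q eta(k)(N - eta(k)) on it,
that is a uniform killing at rate 2q and a source on the diagonal; this
uniformity is what makes the system solvable (moment2_balance).

Because of the killing, the system is strictly diagonally dominant, so it
determines M (contraction_eq0), and in particular M is invariant under rotation.
Substituting
M(k,l) = a (1_{k=l} + (N-1) h(l-k)) reduces it to the equation of a Green
function on the cycle,
  h(d-1) + h(d+1) - beta h(d) = - (beta-2) 1_{d=0}
(moment2E).  Such a Green function is a solution w of the Chebyshev recurrence
w(n+2) = beta w(n+1) - w(n), read as a function of the distance to the antipode
of the pole and suitably reflected there (reflected_green).  When K is even the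
antipode is one site and the reflection w(-1) = w(1) selects the T_n; when K is
odd it is a pair of adjacent sites and w(-1) = w(0) selects the U_n - U_{n-1}.
The identities chebyshevTU and chebyshevVU compute the defect of the recurrence
at the pole, hence the normalizing denominators. *)

(** * Means over configurations *)

Section Mean.
Variables (R : realType) (K N : nat) (nu : probability (config K N) R).
Implicit Types f g : config K N -> R.

Lemma occ_le (eta : config K N) (k : 'Z_K) : (eta k <= N)%N.
Proof. by rewrite -[X in (_ <= X)%N](eqP (occ_sum eta)) (bigD1 k) //= leq_addr. Qed.

(** Boundedness comes from finiteness: a configuration is determined by its
occupation numbers, which range over the finite type of functions into
[0, N]. *)
Lemma config_bounded f : exists M, forall eta, `|f eta| <= M.
Proof.
pose code (eta : config K N) : {ffun 'Z_K -> 'I_N.+1} := [ffun k => inord (eta k)].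
pose decode (c : {ffun 'Z_K -> 'I_N.+1}) : config K N :=
  insubd (point : config K N) [ffun k => val (c k)].
have codeK eta : decode (code eta) = eta.
  rewrite /decode (_ : [ffun k => _] = occ eta) ?valKd //.
  by apply/ffunP => k; rewrite !ffunE /= inordK ?ltnS ?occ_le.
exists (\sum_c `|f (decode c)|) => eta.
by rewrite (bigD1 (code eta)) //= codeK lerDl sumr_ge0.
Qed.

Lemma config_Lfun1 f : f \in Lfun nu 1.
Proof.
apply/Lfun1_integrable; apply: measurable_bounded_integrable => //.
  exact: le_lt_trans (probability_le1 nu measurableT) (ltry 1).
have [M fM] := config_bounded f; exists M; split; first exact: num_real.
by move=> x Mx eta _ /=; apply: le_trans (fM eta) (ltW Mx).
Qed.

(** The real-valued expectation; it loses nothing since every function on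
configurations is integrable. *)
Definition mean f : R := fine ('E_nu[f])%E.

Lemma expectation_mean f : ('E_nu[f] = (mean f)%:E)%E.
Proof. by rewrite fineK // expectation_fin_num // config_Lfun1. Qed.

Lemma meanD f g : mean (fun eta => f eta + g eta) = mean f + mean g.
Proof.
apply: EFin_inj; rewrite EFinD -!expectation_mean.
exact: expectationD (config_Lfun1 f) (config_Lfun1 g).
Qed.

Lemma meanZ a f : mean (fun eta => a * f eta) = a * mean f.
Proof.
apply: EFin_inj; rewrite EFinM -!expectation_mean.
rewrite -(expectationZl a (config_Lfun1 f)); congr expectation.
by apply/funext => eta /=; rewrite mulrC.
Qed.

Lemma mean_cst a : mean (fun=> a) = a.
Proof. by apply: EFin_inj; rewrite -expectation_mean expectation_cst. Qed.

Lemma mean_sum (I : finType) (F : I -> config K N -> R) :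
  mean (fun eta => \sum_i F i eta) = \sum_i mean (F i).
Proof.
rewrite unlock; elim: (index_enum I) => [|i s IHs] /=; first exact: mean_cst.
by rewrite meanD IHs.
Qed.

Lemma covariance_mean f g :
  covariance nu f g = (mean (fun eta => f eta * g eta) - mean f * mean g)%:E.
Proof. by rewrite covarianceE ?config_Lfun1 // !expectation_mean. Qed.

End Mean.

(** * The generator on linear and quadratic functions *)

Lemma sum_delta (R : realType) (I : finType) (F : I -> R) k :
  \sum_i (k == i)%:R * F i = F k.
Proof.
rewrite (bigD1 k) //= eqxx mul1r big1 ?addr0 // => i /negPf ik.
by rewrite eq_sym ik mul0r.
Qed.

Section Generator.
Variables (R : realType) (K N : nat) (theta p : R).
Implicit Types (eta : config K N) (i j k l : 'Z_K).
Local Notation rate := (jump_rate theta p).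

Lemma sum_occ eta : \sum_k (eta k)%:R = N%:R :> R.
Proof. by rewrite -natr_sum (eqP (occ_sum eta)). Qed.

Lemma occ_jump eta i j k : (0 < eta i)%N ->
  (jump i j eta k)%:R = (eta k)%:R - (k == i)%:R + (k == j)%:R :> R.
Proof.
move=> eta_gt0; rewrite jumpE // ffunE natrD natrB //.
by case: eqP => [->|].
Qed.

(** The rate of a jump from an empty site is zero, so the increment of f matters
only when the source is occupied, where the truncated subtraction is exact. *)
Lemma generator_increment (f : config K N -> R) (D : 'Z_K -> 'Z_K -> R) eta :
    (forall i j, (0 < eta i)%N -> f (jump i j eta) - f eta = D i j) ->
  generator theta p f eta = \sum_i \sum_j rate eta i j * D i j.
Proof.
move=> fD; apply: eq_bigr => i _; apply: eq_bigr => j _.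
have [eta0|eta_gt0] := posnP (eta i); last by rewrite fD.
by rewrite /jump_rate eta0 !mul0r.
Qed.

Lemma outflow eta k : \sum_j rate eta k j =
  (eta k)%:R * (1 + theta + p / (N%:R - 1) * N%:R).
Proof.
rewrite -[X in _ / _ * X](sum_occ eta) -mulr_sumr; congr (_ * _); rewrite !big_split /=; congr (_ + _ + _).
- under eq_bigr => j _ do rewrite eq_sym -[_%:R]mulr1.
  by rewrite (sum_delta (fun=> 1)).
- rewrite -mulr_sumr; under eq_bigr => j _ do rewrite eq_sym -[_%:R]mulr1.
  by rewrite (sum_delta (fun=> 1)) mulr1.
- by rewrite mulr_sumr; apply: eq_bigr => j _; ring.
Qed.

Lemma inflow eta k : \sum_i rate eta i k =
  (eta (k - 1))%:R + theta * (eta (k + 1))%:R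
  + (eta k)%:R * (p / (N%:R - 1) * N%:R).
Proof.
rewrite -[X in _ / _ * X](sum_occ eta) -(sum_delta (fun i => (eta i)%:R) (k - 1)).
rewrite -(sum_delta (fun i => (eta i)%:R) (k + 1)) !mulr_sumr -!big_split /=.
apply: eq_bigr => i _; rewrite /jump_rate subr_eq -(eq_sym (i - 1)) subr_eq (eq_sym i).
ring.
Qed.

(** The mean-field parts of the inflow and of the outflow agree, so that only the
nearest-neighbour motion survives. *)
Lemma drift eta k : \sum_i rate eta i k - \sum_j rate eta k j =
  (eta (k - 1))%:R + theta * (eta (k + 1))%:R - (1 + theta) * (eta k)%:R.
Proof. by rewrite inflow outflow; ring. Qed.

Lemma sum_rate_delta eta k :
  (\sum_i \sum_j rate eta i j * ((k == j)%:R - (k == i)%:R)) =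
  \sum_i rate eta i k - \sum_j rate eta k j.
Proof.
under eq_bigr => i _ do
  (under eq_bigr => j _ do rewrite mulrBr mulrC; rewrite sumrB sum_delta
     -mulr_suml mulrC).
by rewrite sumrB sum_delta.
Qed.

Lemma generator_occ eta k :
  generator theta p (fun xi => (xi k)%:R) eta =
  (eta (k - 1))%:R + theta * (eta (k + 1))%:R - (1 + theta) * (eta k)%:R.
Proof.
rewrite -drift -sum_rate_delta; apply: generator_increment => i j eta_gt0.
by rewrite occ_jump //; ring.
Qed.

(** The quadratic covariation of eta(k) and eta(l): on the diagonal every jump
into or out of the site counts, off the diagonal only the exchanges between the
two sites do.  The jumps from a site to itself cancel in this formula. *)
Lemma sum_rate_delta2 eta k l :
  \sum_i \sum_j rate eta i j *
     (((k == j)%:R - (k == i)%:R) * ((l == j)%:R - (l == i)%:R)) =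
  (k == l)%:R * (\sum_i rate eta i k + \sum_j rate eta k j)
  - rate eta k l - rate eta l k.
Proof.
have delta2 i : (k == i)%:R * (l == i)%:R = (k == l)%:R * (k == i)%:R :> R.
  by case: (eqVneq k i) => [->|]; rewrite ?mulr0 ?mul0r // mulr1 mul1r eq_sym.
have -> : \sum_i \sum_j rate eta i j *
     (((k == j)%:R - (k == i)%:R) * ((l == j)%:R - (l == i)%:R)) =
   \sum_i \sum_j ((k == l)%:R * ((k == j)%:R * rate eta i j)
                + (k == l)%:R * ((k == i)%:R * rate eta i j)
                - (l == i)%:R * ((k == j)%:R * rate eta i j)
                - (k == i)%:R * ((l == j)%:R * rate eta i j)).
  apply: eq_bigr => i _; apply: eq_bigr => j _.
  by have := delta2 i; have := delta2 j => dj di; ring: dj di.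
under eq_bigr => i _ do
  rewrite !sumrB big_split /= -!mulr_sumr !sum_delta.
by rewrite !sumrB big_split /= -!mulr_sumr !sum_delta; ring.
Qed.

(** Leibniz rule, corrected by the quadratic covariation of sum_rate_delta2. *)
Lemma generator_occM eta k l :
  generator theta p (fun xi => (xi k)%:R * (xi l)%:R) eta =
  (eta l)%:R * (\sum_i rate eta i k - \sum_j rate eta k j)
  + (eta k)%:R * (\sum_i rate eta i l - \sum_j rate eta l j)
  + ((k == l)%:R * (\sum_i rate eta i k + \sum_j rate eta k j)
     - rate eta k l - rate eta l k).
Proof.
rewrite -sum_rate_delta2 -!sum_rate_delta !mulr_sumr -!big_split /=.
rewrite (@generator_increment _ (fun i j =>
   (eta l)%:R * ((k == j)%:R - (k == i)%:R)
   + (eta k)%:R * ((l == j)%:R - (l == i)%:R)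
   + ((k == j)%:R - (k == i)%:R) * ((l == j)%:R - (l == i)%:R))).
  apply: eq_bigr => i _; rewrite !mulr_sumr -!big_split /=.
  by apply: eq_bigr => j _; ring.
by move=> i j eta_gt0; rewrite !occ_jump //; ring.
Qed.

End Generator.

(** * Moments of a stationary law *)

(** Testing the balance equation against m gives
sum m(k) m(k+1) = sum m(k)^2, i.e. the Dirichlet energy of m vanishes. *)
Lemma cycle_balance_const (R : realFieldType) (K : nat) (theta : R) (m : 'Z_K -> R) :
    0 < theta ->
    (forall k, m (k - 1) + theta * m (k + 1) - (1 + theta) * m k = 0) ->
  forall k, m k = m 0.
Proof.
move=> theta_gt0 bal.
pose A := \sum_k m k * m (k + 1); pose B := \sum_k m k ^+ 2.
have sumA : \sum_k m k * m (k - 1) = A.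
  rewrite (reindex_inj (addIr (1 : 'Z_K))) /=.
  by apply: eq_bigr => k _; rewrite addrK mulrC.
have sumB : \sum_k m (k + 1) ^+ 2 = B by rewrite /B [RHS](reindex_inj (addIr (1 : 'Z_K))).
have AB : A = B.
  have : \sum_k m k * (m (k - 1) + theta * m (k + 1) - (1 + theta) * m k) = 0.
    by rewrite big1 // => k _; rewrite bal mulr0.
  rewrite (eq_bigr (fun k => m k * m (k - 1) + theta * (m k * m (k + 1))
     - (1 + theta) * m k ^+ 2)) => [|k _]; last by ring.
  rewrite sumrB big_split /= -!mulr_sumr sumA -/A -/B => h; nra.
have : \sum_k (m (k + 1) - m k) ^+ 2 = 0.
  rewrite (eq_bigr (fun k => m (k + 1) ^+ 2 + m k ^+ 2 - 2 * (m k * m (k + 1))))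
    => [|k _]; last by ring.
  by rewrite sumrB big_split /= -!mulr_sumr sumB -/A -/B AB; ring.
move=> /psumr_eq0P step k; rewrite -[k]natr_Zp; elim: (nat_of_ord k) => [|n IHn] //.
have /eqP := step (fun i _ => sqr_ge0 _) n%:R isT.
by rewrite sqrf_eq0 subr_eq0 -IHn -natr1 => /eqP.
Qed.

(** Uniqueness for diagonally dominant systems: the largest |F x| is at most
q times itself, with q < 1. *)
Lemma contraction_eq0 (R : realFieldType) (T : finType) (F : T -> R) (q : R) : q < 1 ->
    (forall b, (forall x, `|F x| <= b) -> forall x, `|F x| <= q * b) ->
  forall x, F x = 0.
Proof.
move=> q_lt1 contr x.
case: (@Order.TotalTheory.arg_maxP _ _ _ x predT (fun y => `|F y|)) => // z _ zmax.
have := contr `|F z| (fun y => zmax y isT) z => Fz.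
have : `|F z| <= 0 by have := normr_ge0 (F z); nra.
move=> Fz0; apply/eqP; rewrite -normr_le0; exact: le_trans (zmax x isT) Fz0.
Qed.

Section Moments.
Variables (R : realType) (K N : nat) (theta p : R) (nu : probability (config K N) R).
Hypotheses (K_gt1 : (1 < K)%N) (N_gt1 : (1 < N)%N) (theta_gt0 : 0 < theta) (p_gt0 : 0 < p).
Hypothesis nu_stat : stationary theta p nu.
Implicit Types (f : config K N -> R) (k l : 'Z_K).

Definition moment2 k l : R := mean nu (fun eta => (eta k)%:R * (eta l)%:R).

Lemma mean_generator f : mean nu (generator theta p f) = 0.
Proof. by rewrite /mean nu_stat. Qed.

Lemma mean_occ k : mean nu (fun eta => (eta k)%:R) = N%:R / K%:R.
Proof.
pose m l := mean nu (fun eta => (eta l)%:R).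
have mE l : m l = m 0.
  apply: (@cycle_balance_const _ _ theta) => // {}l.
  rewrite -(mean_generator (fun eta => (eta l)%:R)) -mulNr /m -!meanZ -!meanD.
  by congr mean; apply/funext => eta; rewrite generator_occ mulNr.
have : \sum_l m l = N%:R.
  rewrite -mean_sum -[RHS](mean_cst nu); congr mean; apply/funext => eta.
  exact: sum_occ.
under eq_bigr do rewrite mE.
rewrite -/(m k) (mE k) sumr_const card_ord Zp_cast // => <-.
by rewrite -[_ *+ K]mulr_natr mulfK // pnatr_eq0; lia.
Qed.

(** Stationarity tested on eta(k)eta(l); the mean-field terms contribute the
killing 2q on the left and a source on the diagonal. *)
Lemma moment2_balance k l :
  let a := N%:R / K%:R in
  let q := p / (N%:R - 1) in
  (2 * (1 + theta) + 2 * q) * moment2 k l =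
    moment2 (k - 1) l + theta * moment2 (k + 1) l
    + moment2 k (l - 1) + theta * moment2 k (l + 1)
    + (k == l)%:R * (2 * a * (1 + theta + q * N%:R))
    - (1 + theta) * a * ((l == k + 1)%:R + (k == l + 1)%:R).
Proof.
move=> a q.
have := mean_generator (fun eta => (eta k)%:R * (eta l)%:R).
have -> : generator theta p (fun eta : config K N => (eta k)%:R * (eta l)%:R) =
  fun eta : config K N =>
    ((((eta (k - 1))%:R * (eta l)%:R + theta * ((eta (k + 1))%:R * (eta l)%:R)
    + (eta k)%:R * (eta (l - 1))%:R + theta * ((eta k)%:R * (eta (l + 1))%:R))
    + (- (2 * (1 + theta) + 2 * q)) * ((eta k)%:R * (eta l)%:R))
    + ((k == l)%:R * ((eta (k - 1))%:R + theta * (eta (k + 1))%:R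
        + (1 + theta + 2 * q * N%:R) * (eta k)%:R)
      + (- ((l == k + 1)%:R + theta * (k == l + 1)%:R)) * (eta k)%:R
      + (- ((k == l + 1)%:R + theta * (l == k + 1)%:R)) * (eta l)%:R)).
  apply/funext => eta; rewrite generator_occM !drift inflow outflow /jump_rate.
  rewrite (eq_sym l (k - 1)) (eq_sym k (l - 1)) !subr_eq /q.
  by ring.
rewrite !(meanD, meanZ) !mean_occ -/a -/(moment2 _ _) => h.
apply/eqP; rewrite -subr_eq0 -oppr_eq0 -[X in _ == X]h; apply/eqP.
by rewrite /moment2; ring.
Qed.

(** The ansatz satisfies moment2_balance whenever h is the Green function: its
diagonal part absorbs the nearest-neighbour sources and leaves on the diagonal
the source 2 a q (N-1) = a (N-1) (1+theta) (beta-2), which is that of h.  The difference of two solutions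
solves the homogeneous system, which is a contraction of ratio
2(1+theta)/(2(1+theta)+2q). *)
Lemma moment2E (h : 'Z_K -> R) (beta := 2 * (1 + p / ((N%:R - 1) * (1 + theta)))) :
    (forall d, h (d - 1) + h (d + 1) - beta * h d = - (beta - 2) * (d == 0)%:R) ->
  forall k l, moment2 k l = N%:R / K%:R * ((k == l)%:R + (N%:R - 1) * h (l - k)).
Proof.
move=> h_green; have theta0 := theta_gt0.
pose a : R := N%:R / K%:R; pose q := p / (N%:R - 1).
have N1_gt0 : 0 < N%:R - 1 :> R by rewrite subr_gt0 ltr1n.
have q_gt0 : 0 < q by rewrite divr_gt0.
pose C k l := a * ((k == l)%:R + (N%:R - 1) * h (l - k)).
have C_balance k l : (2 * (1 + theta) + 2 * q) * C k l =
    C (k - 1) l + theta * C (k + 1) l + C k (l - 1) + theta * C k (l + 1)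
    + (k == l)%:R * (2 * a * (1 + theta + q * N%:R))
    - (1 + theta) * a * ((l == k + 1)%:R + (k == l + 1)%:R).
  have := h_green (l - k); rewrite subr_eq0 (eq_sym l k) => green.
  have theta1 : 1 + theta != 0 by rewrite gt_eqF ?addr_gt0.
  have beta_q : (1 + theta) * (beta - 2) = 2 * q.
    by rewrite /beta /q; field; rewrite theta1 /= gt_eqF.
  rewrite /C (_ : l - (k - 1) = l - k + 1); last by ring.
  rewrite (_ : l - (k + 1) = l - k - 1); last by ring.
  rewrite (_ : l - 1 - k = l - k - 1); last by ring.
  rewrite (_ : l + 1 - k = l - k + 1); last by ring.
  rewrite (eq_sym (k + 1)) (eq_sym k (l - 1)) !subr_eq.
  move: green beta_q; set e := (k == l)%:R; set e1 := (k == l + 1)%:R.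
  set e2 := (l == k + 1)%:R; set h0 := h (l - k) => green beta_q.
  clear C h_green; clearbody a q beta.
  have -> : h (l - k + 1) = - (beta - 2) * e + beta * h0 - h (l - k - 1)
    by rewrite -green; ring.
  have -> : beta = 2 + 2 * q / (1 + theta) by rewrite -beta_q; field.
  by field.
have [c_gt0 rho_lt] : 0 < 2 * (1 + theta) + 2 * q /\
    2 * (1 + theta) / (2 * (1 + theta) + 2 * q) < 1.
  by split; [lra | rewrite ltr_pdivrMr; lra].
move=> k l; apply/eqP; rewrite -subr_eq0; apply/eqP.
pose D (kl : 'Z_K * 'Z_K) := moment2 kl.1 kl.2 - C kl.1 kl.2.
apply: (@contraction_eq0 _ _ D _ rho_lt _ (k, l)) => b Db [{}k {}l].
have D_balance : (2 * (1 + theta) + 2 * q) * D (k, l) =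
    D (k - 1, l) + theta * D (k + 1, l) + D (k, l - 1) + theta * D (k, l + 1).
  by rewrite /D mulrBr C_balance moment2_balance -/a -/q /=; ring.
rewrite mulrAC ler_pdivlMr // mulrC -[X in X * _](gtr0_norm c_gt0) -normrM D_balance.
move: (Db (k - 1, l)) (Db (k + 1, l)) (Db (k, l - 1)) (Db (k, l + 1)).
by rewrite !ler_norml => /andP[? ?] /andP[? ?] /andP[? ?] /andP[? ?]; apply/andP; split; nra.
Qed.

Lemma covariance_green (h : 'Z_K -> R) (beta := 2 * (1 + p / ((N%:R - 1) * (1 + theta)))) :
    (forall d, h (d - 1) + h (d + 1) - beta * h d = - (beta - 2) * (d == 0)%:R) ->
  forall k l, covariance nu (proportion R k) (proportion R l) =
    ((N%:R - 1) / (K%:R * N%:R) * h (l - k)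
     + (k == l)%:R / (K%:R * N%:R) - 1 / K%:R ^+ 2)%:E.
Proof.
move=> h_green k l; rewrite covariance_mean; congr _%:E.
have N0 : N%:R != 0 :> R by rewrite pnatr_eq0; lia.
have K0 : K%:R != 0 :> R by rewrite pnatr_eq0; lia.
have mean_proportion j : mean nu (proportion R j) = 1 / K%:R.
  rewrite (_ : proportion R j = fun eta => N%:R^-1 * (eta j)%:R).
    by rewrite meanZ mean_occ; field; rewrite K0.
  by apply/funext => eta; rewrite /proportion mulrC.
rewrite !mean_proportion.
rewrite (_ : mean nu _ = N%:R ^- 2 * moment2 k l).
  by rewrite (moment2E h_green); field; rewrite K0.
by rewrite -meanZ; congr mean; apply/funext => eta; rewrite /proportion; field.
Qed.

End Moments.

(** * Green functions on the cycle *)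

(** The distance from site n < 2 K2 + e to the antipode of 0, which is the site
K2 if e = 0 and the pair {K2, K2 + 1} if e = 1; of the two truncated terms at
most one is nonzero. *)
Definition reflect_index (K2 e n : nat) : nat := (K2 - n + (n - (K2 + e)))%N.

(** Away from 0 and from the antipode the neighbours of a site lie at the
neighbouring distances, so the recurrence applies.  At the antipode, one
neighbour is at distance 1 and the other at distance 1 - e: itself a reflected
site if e = 0, the other half of the pair if e = 1.  At 0 both neighbours are at
distance K2 - 1. *)
Lemma reflected_green (R : comNzRingType) (K K2 e : nat) (b : R) (w : nat -> R) :
    (1 < K)%N -> K = (2 * K2 + e)%N -> (e <= 1)%N ->
    (forall n, w n.+2 = b * w n.+1 - w n) ->
    w 1%N + w (1 - e)%N = b * w 0%N ->
  let h (d : 'Z_K) := w (reflect_index K2 e d) in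
  forall d, h (d - 1) + h (d + 1) - b * h d =
    (2 * w K2.-1 - b * w K2) * (d == 0)%:R.
Proof.
case: K => [|[|K]] // _ KE e_le1 wrec w_end h d.
have [n nE ltnK] : exists2 n, nat_of_ord d = n & (n < K.+2)%N by exists d.
have val_succ : nat_of_ord (d + 1) = if n.+1 == K.+2 then 0%N else n.+1.
  rewrite /= nE -[(Zp_trunc _).+2]/K.+2 modnDmr addn1; case: eqP => [->|nK]; first by rewrite modnn.
  by rewrite modn_small; lia.
have val_pred : nat_of_ord (d - 1) = if n == 0%N then K.+1 else n.-1.
  rewrite /= nE -[(Zp_trunc _).+2]/K.+2 modnDmr (@modn_small 1 K.+2) //.
  case: eqP => [->|n0]; first by rewrite add0n modn_small; lia.
  by rewrite (_ : (n + (K.+2 - 1) = n.-1 + K.+2)%N) ?modnDr ?modn_small; lia.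
have val0 : (d == 0) = (n == 0%N) by rewrite -nE.
rewrite /h val_succ val_pred val0 nE /reflect_index.
have wn m m1 m2 : (m1 = m.+1)%N -> (m2 = m.+2)%N -> w m + w m2 - b * w m1 = 0.
  by move=> -> ->; rewrite wrec; ring.
case: (eqVneq n 0%N) => [->|n0].
  case: eqP => [|_]; first by lia.
  rewrite [in w (_ + (K.+1 - _))%N](_ : (_ + _ = K2.-1)%N); last by lia.
  rewrite [in w (K2 - 1 + _)%N](_ : (_ + _ = K2.-1)%N); last by lia.
  by rewrite subn0 sub0n addn0 mulr1; ring.
rewrite mulr0.
(* Here i, j and c are the distances of d - 1, d + 1 and d: increasing by one
   towards the pole, or folded at the antipode. *)
set i := (X in w X + _ - _); set j := (X in _ + w X - _); set c := (X in b * w X).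
have [jE|[ciE|[c0 [[i1 j1]|[i1 j1]]]]] : (i = c.+1 /\ c = j.+1) \/ (j = c.+1 /\ c = i.+1)
   \/ c = 0%N /\ (i = 1%N /\ j = (1 - e)%N \/ i = (1 - e)%N /\ j = 1%N).
- rewrite /i /j /c.
  have [nK|nK|nK] := ltngtP n K2.
  + by left; case: eqP => ?; lia.
  + have [nKe|nKe] := eqVneq n (K2 + e)%N.
      by do 2 right; split; [lia | right; case: eqP => ?; lia].
    by right; left; case: eqP => ?; lia.
  + by do 2 right; split; [lia | left; case: eqP => ?; lia].
- by rewrite [w i + _]addrC; apply: wn; lia.
- by apply: wn; lia.
- by rewrite i1 j1 c0 -w_end; ring.
- by rewrite i1 j1 c0 -w_end; ring.
Qed.

(** * Chebyshev polynomials *)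

Section Chebyshev.
Variables (R : realType) (x : R).
Let T n : R := (chebyshevT R n).[x].
Let U n : R := (chebyshevU R n).[x].

Lemma chebyshevT_rec n : T n.+2 = 2 * x * T n.+1 - T n.
Proof. by rewrite /T /chebyshevT /= !hornerE. Qed.

Lemma chebyshevU_rec (n : nat) : U n.+2 = 2 * x * U n.+1 - U n.
Proof. by rewrite /U /chebyshevU /= !hornerE. Qed.

Lemma chebyshevT0 : T 0%N = 1.
Proof. by rewrite /T /chebyshevT /= hornerC. Qed.

Lemma chebyshevT1 : T 1%N = x.
Proof. by rewrite /T /chebyshevT /= hornerX. Qed.

Lemma chebyshevU0 : U 0%N = 1.
Proof. by rewrite /U /chebyshevU /= hornerC. Qed.

Lemma chebyshevU1 : U 1%N = 2 * x.
Proof. by rewrite /U /chebyshevU /= !hornerE. Qed.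

Lemma chebyshevU_gt0 (n : nat) : 1 <= x -> 0 < U n /\ U n <= U n.+1.
Proof.
move=> x_ge1; elim: n => [|n [IH1 IH2]].
  by rewrite chebyshevU0 chebyshevU1; lra.
by rewrite chebyshevU_rec; split; nra.
Qed.

(** Both sides solve the same second-order recurrence in n. *)
Lemma chebyshevTU (n : nat) : T n - x * T n.+1 = (1 - x ^+ 2) * U n.
Proof.
(* The induction carries two consecutive indices, as the recurrence has order two. *)
suff [] : T n - x * T n.+1 = (1 - x ^+ 2) * U n
  /\ T n.+1 - x * T n.+2 = (1 - x ^+ 2) * U n.+1 by [].
elim: n => [|n [IH1 IH2]].
  by rewrite chebyshevT_rec chebyshevT1 chebyshevT0 chebyshevU0 chebyshevU1; split; ring.
split=> //; rewrite chebyshevU_rec mulrBr mulrCA -IH2 -IH1.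
by rewrite (chebyshevT_rec n.+1) (chebyshevT_rec n); ring.
Qed.

(** The Chebyshev polynomials of the third kind. *)
Definition chebyshevV (n : nat) : R := U n - U (n%:Z - 1).

Lemma chebyshevU_pred (n : nat) : U (n.+1%:Z - 1) = U n.
Proof. by rewrite intS addrAC subrr add0r. Qed.

Lemma chebyshevU_pred0 : U (0%:Z - 1) = 0.
Proof. by rewrite /U /= horner0. Qed.

Lemma chebyshevV_rec n : chebyshevV n.+2 = 2 * x * chebyshevV n.+1 - chebyshevV n.
Proof.
rewrite /chebyshevV !chebyshevU_pred chebyshevU_rec; case: n => [|n].
  by rewrite chebyshevU_pred0 chebyshevU0 chebyshevU1; ring.
by rewrite chebyshevU_pred chebyshevU_rec; ring.
Qed.

Lemma chebyshevVU n :
  chebyshevV n - x * chebyshevV n.+1 = (1 - x) * (U n.+1 + U (n.+1%:Z - 1)).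
Proof.
rewrite /chebyshevV !chebyshevU_pred; case: n => [|n].
  by rewrite chebyshevU_pred0 chebyshevU0 chebyshevU1; ring.
by rewrite chebyshevU_pred chebyshevU_rec; ring.
Qed.

End Chebyshev.

(** * The covariances *)

Theorem theorem1p4 (R : realType) (K N : nat) (theta p : R)
    (nu : probability (config K N) R)
    (hK : (3 <= K)%N) (hN : (2 <= N)%N) (htheta : 0 < theta) (hp : 0 < p)
    (hnu : stationary theta p nu) :
  let beta : R := 2 * (1 + p / ((N%:R - 1) * (1 + theta))) in
  let T (n : nat) : R := (chebyshevT R n).[beta / 2] in
  let U (n : int) : R := (chebyshevU R n).[beta / 2] in
  let X (k : nat) : config K N -> R := proportion R (k%:R : 'Z_K) in
  (forall K2 : nat, K = (2 * K2)%N -> (2 <= K2)%N ->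
     ('V_nu[X 0%N])%E =
       ((N%:R - 1) / (K%:R * N%:R) * (2 / (beta + 2))
          * (T K2 / U (K2%:Z - 1))
        + 1 / (K%:R * N%:R) - 1 / K%:R ^+ 2)%:E
     /\ forall k : nat, (1 <= k <= K2 - 1)%N ->
       covariance nu (X 0%N) (X k) =
         ((N%:R - 1) / (K%:R * N%:R) * (2 / (beta + 2))
            * (T (K2 - k)%N / U (K2%:Z - 1))
          - 1 / K%:R ^+ 2)%:E)
  /\
  (forall K2 : nat, K = (2 * K2 + 1)%N -> (1 <= K2)%N ->
     ('V_nu[X 0%N])%E =
       ((N%:R - 1) / (K%:R * N%:R)
          * ((U K2%:Z - U (K2%:Z - 1)) / (U K2%:Z + U (K2%:Z - 1)))
        + 1 / (K%:R * N%:R) - 1 / K%:R ^+ 2)%:E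
     /\ forall k : nat, (1 <= k <= K2)%N ->
       covariance nu (X 0%N) (X k) =
         ((N%:R - 1) / (K%:R * N%:R)
            * ((U (K2%:Z - k%:Z) - U (K2%:Z - k%:Z - 1))
               / (U K2%:Z + U (K2%:Z - 1)))
          - 1 / K%:R ^+ 2)%:E).
Proof.
move=> beta T U X.
have K_gt1 : (1 < K)%N by exact: ltnW.
have beta_gt2 : 2 < beta.
  have N1_gt0 : 0 < N%:R - 1 :> R by rewrite subr_gt0 ltr1n.
  by rewrite /beta ltr_pMr // ltrDl divr_gt0 // mulr_gt0 // addr_gt0 //.
have beta2 : 2 * (beta / 2) = beta by rewrite mulrC divfK.
have betaE y : beta * y = 2 * (beta / 2 * y) by rewrite mulrA beta2.
have x_ge1 : 1 <= beta / 2 by lra.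
(* The common form of both parities: w is the Chebyshev solution and D, computed
   from its defect at the pole, normalizes it. *)
have cov (K2 e : nat) (w : nat -> R) (D : R) : K = (2 * K2 + e)%N -> (e <= 1)%N ->
    (forall n, w n.+2 = beta * w n.+1 - w n) ->
    w 1%N + w (1 - e)%N = beta * w 0%N -> D != 0 ->
    2 * w K2.-1 - beta * w K2 = - (beta - 2) * D ->
    forall k, (k <= K2)%N -> covariance nu (X 0%N) (X k) =
      ((N%:R - 1) / (K%:R * N%:R) * (w (K2 - k)%N / D)
       + (k == 0%N)%:R / (K%:R * N%:R) - 1 / K%:R ^+ 2)%:E.
  move=> KE e_le1 wrec w_end D0 wD k kK2.
  have h_green := reflected_green K_gt1 KE e_le1 wrec w_end.
  pose h (d : 'Z_K) := w (reflect_index K2 e d) / D.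
  have kK : nat_of_ord (k%:R : 'Z_K) = k by rewrite val_Zp_nat // modn_small //; lia.
  rewrite (@covariance_green _ _ _ _ _ _ K_gt1 hN htheta hp hnu h) -/beta.
    rewrite subr0 /h kK (_ : reflect_index K2 e k = K2 - k)%N; last first.
      by rewrite /reflect_index; lia.
    by rewrite eq_sym -val_eqE /= kK.
  move=> d; rewrite /h mulrA -!mulrDl -mulrBl.
  by rewrite h_green wD mulrAC mulfK.
split=> K2 KE K2_gt.
- have U_neq0 : U (K2%:Z - 1) != 0.
    case: K2 KE K2_gt => // m _ _; rewrite /U chebyshevU_pred gt_eqF //.
    by case: (chebyshevU_gt0 m x_ge1).
  have beta2_neq0 : beta + 2 != 0 by rewrite gt_eqF //; lra.
  have {}cov k : (k <= K2)%N -> covariance nu (X 0%N) (X k) =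
     ((N%:R - 1) / (K%:R * N%:R) * (2 / (beta + 2)) * (T (K2 - k)%N / U (K2%:Z - 1))
      + (k == 0%N)%:R / (K%:R * N%:R) - 1 / K%:R ^+ 2)%:E.
    move=> kK2.
    rewrite (cov K2 0%N T (U (K2%:Z - 1) * ((beta + 2) / 2))) ?addn0 //.
    + congr (_ + _ - _)%:E; rewrite -[in RHS]mulrA; congr (_ * _); field.
      by rewrite beta2_neq0 U_neq0.
    + by move=> n; rewrite /T chebyshevT_rec beta2.
    + by rewrite subn0 /T chebyshevT1 chebyshevT0; field.
    + by rewrite !mulf_neq0 ?invr_eq0.
    + case: K2 K2_gt {KE U_neq0 kK2 cov} => // m _; rewrite /U chebyshevU_pred /=.
      by rewrite (betaE (T _)) -mulrBr chebyshevTU; field.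
  split.
    by rewrite /variance cov // subn0 eqxx.
  move=> k /andP[k_gt0 kK2]; rewrite cov; last by lia.
  by rewrite gtn_eqF // mul0r addr0.
- have U_neq0 : U K2%:Z + U (K2%:Z - 1) != 0.
    case: K2 KE K2_gt => // m _ _; rewrite /U chebyshevU_pred gt_eqF //.
    by case: (chebyshevU_gt0 m x_ge1) => Um Um1; lra.
  have {}cov k : (k <= K2)%N -> covariance nu (X 0%N) (X k) =
     ((N%:R - 1) / (K%:R * N%:R) * ((U (K2%:Z - k%:Z) - U (K2%:Z - k%:Z - 1))
               / (U K2%:Z + U (K2%:Z - 1)))
      + (k == 0%N)%:R / (K%:R * N%:R) - 1 / K%:R ^+ 2)%:E.
    move=> kK2; rewrite (subzn kK2).
    rewrite (cov K2 1%N (chebyshevV (beta / 2)) (U K2%:Z + U (K2%:Z - 1))) //.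
    + by move=> n; rewrite chebyshevV_rec beta2.
    + rewrite /chebyshevV chebyshevU_pred chebyshevU_pred0 chebyshevU0 chebyshevU1.
      by field.
    + case: K2 K2_gt {KE U_neq0 kK2 cov} => // m _ /=.
      by rewrite (betaE (chebyshevV _ _)) -mulrBr chebyshevVU /U; field.
  split.
    by rewrite /variance cov // subr0 eqxx.
  move=> k /andP[k_gt0 kK2]; rewrite cov //.
  by rewrite gtn_eqF // mul0r addr0.
Qed.
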